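(* For every odd integer $a>1$, the sequence $(x_n^{(a)})_{n\ge1}$ essentially coincides with $(x_n^{(3)})_{n\ge1}$, i.e. there is $n_0$ such that $x_n^{(a)}=x_n^{(3)}$ for all $n\geq n_0$.
   Context: For a positive integer $m$, let $\nu_2(m)$ be the exponent of the highest power of $2$ dividing $m$. For an odd integer $a>1$ (so $\nu_2(a)=\nu_2(1)=0$), define $x_1^{(a)}=a$ and, for $n\ge2$, $x_n^{(a)}$ is the smallest integer $y>x_{n-1}^{(a)}$ with $\nu_2(y)=\nu_2(n)$. (For example $x^{(3)}$ begins $3,6,7,12,13,14,15,24,\dots$.) *)

(* Defs.v *)
From mathcomp Require Import all_boot.

Set Implicit Arguments.
Unset Strict Implicit.
Unset Printing Implicit Defensive.

Definition nu2 (m : nat) : nat := logn 2 m.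

Lemma next_nu2_exists (m n : nat) : exists y, (m < y) && (nu2 y == nu2 n).
Proof.
exists (2 ^ nu2 n * m.*2.+1); rewrite /nu2; apply/andP; split.
  apply: (@leq_trans m.*2.+1); first by rewrite ltnS -addnn leq_addr.
  by rewrite leq_pmull // expn_gt0.
rewrite lognM ?expn_gt0 // pfactorK // [logn 2 m.*2.+1]lognE.
by rewrite dvdn2 /= odd_double /= addn0.
Qed.

(* The smallest y > m with nu2 y = nu2 n; such a y is positive, so the
   convention logn 2 0 = 0 plays no role when n > 0. *)
Definition next_nu2 (m n : nat) : nat := ex_minn (next_nu2_exists m n).

(* The sequence is indexed from 1; the value 0 at index 0 is a dummy. *)
Fixpoint xseq (a n : nat) : nat :=
  match n with
  | 0 => 0
  | k.+1 => if k == 0 then a else next_nu2 (xseq a k) k.+1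
  end.

(* Main.v *)
Require Import Defs.
From mathcomp Require Import all_boot.
From mathcomp Require Import zify.

(** If x_{2^k} = q 2^k with q odd, then nu2 (2^k + i) = nu2 i = nu2 (q 2^k + i)
    for 0 < i < 2^k, so the sequence runs through consecutive integers up to
    x_{2^(k+1) - 1} = (q + 1) 2^k - 1.  Hence x_{2^(k+1)} = q' 2^(k+1), where q'
    is the least odd integer >= (q + 1) / 2.  The map q |-> q' fixes 3 and
    decreases every odd q > 3 while keeping it above 1, so iterating it from a
    leads to 3, that is, to an index k with x_{2^k} = 3 * 2^k; from there on the
    sequence is the one with a = 3. *)

Lemma lognD_dvdl (p k m n : nat) :
  p ^ k %| m -> ~~ (p ^ k %| n) -> logn p (m + n) = logn p n.
Proof.
move=> dvd_m ndvd_n.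
case p_pr: (prime p); last by rewrite lognE [RHS]lognE p_pr.
have n_gt0 : 0 < n by case: n ndvd_n; rewrite ?dvdn0.
have mn_gt0 : 0 < m + n by rewrite addn_gt0 n_gt0 orbT.
have leq_logD j : j <= k -> (j <= logn p (m + n)) = (j <= logn p n).
  move=> le_jk; rewrite -!pfactor_dvdn // dvdn_addr //.
  exact: dvdn_trans (dvdn_exp2l p le_jk) dvd_m.
have lt_logn_k : logn p n < k by rewrite ltnNge -pfactor_dvdn.
by apply/eqP; rewrite eqn_leq leqNgt !leq_logD ?ltnn ?leqnn // ltnW.
Qed.

Lemma nu2_addl_small (k m i : nat) :
  2 ^ k %| m -> 0 < i < 2 ^ k -> nu2 (m + i) = nu2 i.
Proof.
move=> dvd_m /andP[i_gt0 lt_i].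
by apply: (@lognD_dvdl 2 k) => //; rewrite gtnNdvd.
Qed.

Lemma nu2_odd_mul (q k : nat) : odd q -> nu2 (q * 2 ^ k) = k.
Proof. by move=> odd_q; rewrite /nu2 logn_Gauss ?coprime2n // pfactorK. Qed.

Lemma nu2_odd_factor (y : nat) :
  0 < y -> exists2 r, odd r & y = r * 2 ^ nu2 y.
Proof.
move=> y_gt0; have [//|r co_r def_y] := @pfactor_coprime 2 y _ y_gt0.
by exists r; rewrite // -coprime2n.
Qed.

Definition odd_ceil (m : nat) : nat := m + ~~ odd m.

Lemma odd_odd_ceil (m : nat) : odd (odd_ceil m).
Proof. by rewrite /odd_ceil oddD; case: odd. Qed.

Lemma odd_ceil_leq (m r : nat) : odd r -> (odd_ceil m <= r) = (m <= r).
Proof. by rewrite /odd_ceil; lia. Qed.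

Definition odd_uphalf (q : nat) : nat := odd_ceil (uphalf q).

Lemma iter_odd_uphalf_eq3 (q : nat) :
  odd q -> 1 < q -> exists k, iter k odd_uphalf q = 3.
Proof.
elim/ltn_ind: q => q IHq odd_q q_gt1.
have [->|q_neq3] := eqVneq q 3; first by exists 0.
have [lt_q' q'_gt1] : odd_uphalf q < q /\ 1 < odd_uphalf q.
  by rewrite /odd_uphalf /odd_ceil; lia.
have [k iter_q'] := IHq _ lt_q' (odd_odd_ceil _) q'_gt1.
by exists k.+1; rewrite iterSr.
Qed.

Lemma next_nu2_eq (m n y : nat) :
  m < y -> nu2 y = nu2 n -> (forall z, m < z -> nu2 z = nu2 n -> y <= z) ->
  next_nu2 m n = y.
Proof.
move=> lt_my nu_y min_y; rewrite /next_nu2; case: ex_minnP => z.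
case/andP=> lt_mz /eqP nu_z min_z; apply/eqP; rewrite eqn_leq.
by rewrite min_y // min_z // lt_my nu_y eqxx.
Qed.

Lemma next_nu2_succ (m n : nat) : nu2 m.+1 = nu2 n -> next_nu2 m n = m.+1.
Proof. by move=> nu_m; apply: next_nu2_eq. Qed.

Lemma next_nu2_pred_mul (m k n : nat) : 0 < m -> nu2 n = k ->
  next_nu2 (m * 2 ^ k).-1 n = odd_ceil m * 2 ^ k.
Proof.
move=> m_gt0 nu_n; have pow_gt0 : 0 < 2 ^ k by rewrite expn_gt0.
have mul_gt0 : 0 < m * 2 ^ k by rewrite muln_gt0 m_gt0.
apply: next_nu2_eq => [||z].
- by rewrite prednK // leq_pmul2r // leq_addr.
- by rewrite nu2_odd_mul // odd_odd_ceil.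
rewrite prednK // nu_n => le_mz nu_z.
have [r odd_r def_z] := nu2_odd_factor z (leq_trans mul_gt0 le_mz).
by move: le_mz; rewrite def_z nu_z !leq_pmul2r // odd_ceil_leq.
Qed.

Lemma xseqS (a n : nat) : 0 < n -> xseq a n.+1 = next_nu2 (xseq a n) n.+1.
Proof. by case: n. Qed.

Lemma eq_xseq_from (a b m n : nat) :
  0 < m -> xseq a m = xseq b m -> m <= n -> xseq a n = xseq b n.
Proof.
move=> m_gt0 eq_m /subnKC <-; elim: (n - m) => [|i IHi]; first by rewrite addn0.
by rewrite addnS !xseqS ?addn_gt0 ?m_gt0 // IHi.
Qed.

Lemma xseq_add_small (a m k i : nat) :
    0 < m -> 2 ^ k %| m -> 2 ^ k %| xseq a m -> i < 2 ^ k ->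
  xseq a (m + i) = xseq a m + i.
Proof.
move=> m_gt0 dvd_m dvd_xm; elim: i => [|i IHi] lt_i; first by rewrite !addn0.
rewrite !addnS xseqS ?addn_gt0 ?m_gt0 // IHi; last exact: ltnW.
by apply: next_nu2_succ; rewrite -!addnS !(nu2_addl_small k).
Qed.

Lemma xseq_pow2S (a q k : nat) : odd q -> xseq a (2 ^ k) = q * 2 ^ k ->
  xseq a (2 ^ k.+1) = odd_uphalf q * 2 ^ k.+1.
Proof.
move=> odd_q x_pow; have pow_gt0 : 0 < 2 ^ k by rewrite expn_gt0.
have powS : 2 ^ k.+1 = (2 ^ k + (2 ^ k).-1).+1 by rewrite expnS; lia.
have x_last : xseq a (2 ^ k + (2 ^ k).-1) = (uphalf q * 2 ^ k.+1).-1.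
  rewrite (xseq_add_small _ _ k) ?x_pow ?dvdn_mull ?ltn_predL //.
  by rewrite expnS mulnA muln2 odd_uphalfK // mulSn; lia.
rewrite [in LHS]powS xseqS ?addn_gt0 ?pow_gt0 // -powS x_last.
apply: next_nu2_pred_mul; last by rewrite /nu2 pfactorK.
by rewrite uphalf_gt0 odd_gt0.
Qed.

Lemma xseq_pow2 (a k : nat) :
  odd a -> xseq a (2 ^ k) = iter k odd_uphalf a * 2 ^ k.
Proof.
move=> odd_a; have odd_iter j : odd (iter j odd_uphalf a).
  by case: j => //= j; apply: odd_odd_ceil.
elim: k => [|k IHk]; first by rewrite muln1.
exact: xseq_pow2S (odd_iter k) IHk.
Qed.

Theorem theorem2 (a : nat) (odd_a : odd a) (a_gt1 : 1 < a) :
  exists n0 : nat, forall n : nat, n0 <= n -> xseq a n = xseq 3 n.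
Proof.
have [k iter_a] := iter_odd_uphalf_eq3 a odd_a a_gt1.
have iter_3 : iter k odd_uphalf 3 = 3 by apply: iter_fix.
exists (2 ^ k) => n; apply: eq_xseq_from; first by rewrite expn_gt0.
by rewrite !xseq_pow2 // iter_a iter_3.
Qed.
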